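(* Let $X_1,\ldots,X_n,Y,Z,W$ be sequence classes such that $Z$ and $W$ are finitely determined and finitely shrinking. Suppose also that $W\stackrel{\rm fin}{\le}Y$, that $X_i\subseteq Z$ and $X_i\stackrel{\rm fin}{\le}Z$ for every $i=1,\ldots,n$, that $X_k\subseteq Z^u$ for some $k\in\{1,\ldots,n\}$, and that $W^u\subseteq Y$. Then $\Pi_{X_1,\ldots,X_n;Y}=\Pi_{^nZ;W}$ (i.e. $\Pi_{X_1,\ldots,X_n;Y}(E_1,\ldots,E_n;F)=\Pi_{^nZ;W}(E_1,\ldots,E_n;F)$ for all Banach spaces $E_1,\ldots,E_n,F$).
   Context: Banach spaces are over $\mathbb{K}=\mathbb{R}$ or $\mathbb{C}$; $\mathcal{L}(E_1,\ldots,E_n;F)$ is the space of continuous $n$-linear operators. $c_{00}(E)$ and $\ell_\infty(E)$ are the spaces of eventually null and of bounded $E$-valued sequences (the latter with the sup norm). $E\stackrel{1}{\hookrightarrow}F$ means that $E$ is a linear subspace of $F$ and $\|\cdot\|_F\le\|\cdot\|_E$ on $E$. For sequence classes, $X\subseteq Y$ means $X(E)\subseteq Y(E)$ for every $E$. $(x_j)_{j=1}^k$ also denotes the sequence $(x_1,\ldots,x_k,0,0,\ldots)$. Sequence class: a rule $X$ assigning to each Banach space $E$ a Banach space $X(E)$ of $E$-valued sequences such that $c_{00}(E)\subseteq X(E)\stackrel{1}{\hookrightarrow}\ell_\infty(E)$ and $\|e_j\|_{X(\mathbb{K})}=1$ for every $j\in\mathbb{N}$, where $e_j$ is the $j$-th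 canonical unit scalar sequence. Given sequence classes $X_1,\ldots,X_n,Y$, an operator $A\in\mathcal{L}(E_1,\ldots,E_n;F)$ is $(X_1,\ldots,X_n;Y)$-summing, written $A\in\Pi_{X_1,\ldots,X_n;Y}(E_1,\ldots,E_n;F)$, if $(A(x_j^1,\ldots,x_j^n))_{j=1}^\infty\in Y(F)$ whenever $(x_j^k)_{j=1}^\infty\in X_k(E_k)$, $k=1,\ldots,n$. Its norm is the norm of the induced continuous $n$-linear operator $X_1(E_1)\times\cdots\times X_n(E_n)\to Y(F)$. $\Pi_{^nZ;W}$ denotes $\Pi_{Z,\ldots,Z;W}$ with $Z$ repeated $n$ times. Standing assumptions: every sequence class $X$ is linearly stable, i.e. $\Pi_{X;X}(E;F)=\mathcal{L}(E;F)$ with equal norms for all Banach spaces $E,F$; and whenever $\Pi_{X_1,\ldots,X_n;Y}$ is considered, it is assumed that $(\lambda_j^1\cdots\lambda_j^n)_{j}\in Y(\mathbb{K})$ and $\|(\lambda_j^1\cdots\lambda_j^n)_{j}\|_{Y(\mathbb{K})}\le\prod_{k=1}^n\|(\lambda_j^k)_{j}\|_{X_k(\mathbb{K})}$ for all $(\lambda_j^k)_{j}\in X_k(\mathbb{K})$, $k=1,\ldots,n$ (so that $\Pi_{X_1,\ldots,X_n;Y}$ is a Banach ideal of $n$-linear operators). $X$ is finitely determined if, for every Banach space $E$ and every $(x_j)_{j=1}^\infty\in E^{\mathbb{N}}$, $(x_j)_{j=1}^\infty\in X(E)$ if and only if $\sup_k\|(x_j)_{j=1}^k\|_{X(E)}<\infty$,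 and in this case $\|(x_j)_{j=1}^\infty\|_{X(E)}=\sup_k\|(x_j)_{j=1}^k\|_{X(E)}$. $X$ is finitely shrinking if, for every Banach space $E$, $(x_j)_{j=1}^\infty\in X(E)$ and $k\in\mathbb{N}$, $(x_j)_{j\ne k}:=(x_1,\ldots,x_{k-1},x_{k+1},\ldots)\in X(E)$ and $\|(x_j)_{j\ne k}\|_{X(E)}\le\|(x_j)_{j=1}^\infty\|_{X(E)}$. For $X$ finitely shrinking, $X^u(E)=\{(x_j)_{j=1}^\infty\in X(E):\lim_n\|(x_n,x_{n+1},\ldots)\|_{X(E)}=0\}$ with the norm $\|\cdot\|_{X(E)}$. For sequence classes $X,Y$, $X\stackrel{\rm fin}{\le}Y$ means that, for every Banach space $E$, $\|\cdot\|_{X(E)}\le\|\cdot\|_{Y(E)}$ on $c_{00}(E)$. *)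

(* Defs.v *)
From mathcomp Require Import all_boot.
From Stdlib Require Import Reals.
From Coquelicot Require Import Coquelicot.

Set Implicit Arguments.
Unset Strict Implicit.
Unset Printing Implicit Defensive.

Local Open Scope R_scope.

Variant scalars := RealScalars | ComplexScalars.

Definition field_of (s : scalars) : AbsRing :=
  match s with RealScalars => R_AbsRing | ComplexScalars => C_AbsRing end.

(* K as a Banach space over itself.  Only the class is defined by cases, so
   that the carrier is convertible to [field_of s] when [s] is a variable. *)
Definition self_class (s : scalars) :
    CompleteNormedModule.class_of (field_of s) (field_of s) :=
  match s with
  | RealScalars => CompleteNormedModule.class R_AbsRing R_CompleteNormedModule
  | ComplexScalars => CompleteNormedModule.class C_AbsRing C_CompleteNormedModule
  end.

Notation banach s := (CompleteNormedModule (field_of s)).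

Definition scalar_space (s : scalars) : banach s :=
  CompleteNormedModule.Pack (field_of s) (field_of s) (self_class s) (field_of s).

Section Sequences.
Variable s : scalars.

Definition c00 (E : banach s) (x : nat -> E) : Prop :=
  exists N : nat, forall j : nat, (N <= j)%nat -> x j = zero.

Definition linf_norm (E : banach s) (x : nat -> E) : Rbar :=
  Sup_seq (fun j => Finite (norm (x j))).

Definition linf (E : banach s) (x : nat -> E) : Prop :=
  Rbar_lt (linf_norm x) p_infty.

Definition unit_seq (j : nat) : nat -> scalar_space s :=
  fun m => if m == j then one else zero.

(* (x_1, ..., x_k, 0, 0, ...); sequences are indexed from 0 *)
Definition seq_trunc (E : banach s) (x : nat -> E) (k : nat) : nat -> E :=
  fun j => if (j < k)%nat then x j else zero.

Definition seq_omit (E : banach s) (x : nat -> E) (k : nat) : nat -> E :=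
  fun j => if (j < k)%nat then x j else x j.+1.

Definition seq_tail (E : banach s) (x : nat -> E) (m : nat) : nat -> E :=
  fun j => x (m + j)%nat.

End Sequences.

(* X(E) is the set [seq_mem X E] of sequences, with the coordinatewise operations
   and the norm [seq_norm X E], whose values outside [seq_mem X E] are irrelevant.
   That [seq_norm X E] is nonnegative and definite follows from [seq_norm_linf]. *)
Record seq_class (s : scalars) := SeqClass {
  seq_mem : forall E : banach s, (nat -> E) -> Prop;
  seq_norm : forall E : banach s, (nat -> E) -> R;
  seq_mem_plus : forall (E : banach s) (x y : nat -> E),
    seq_mem x -> seq_mem y -> seq_mem (fun j => plus (x j) (y j));
  seq_mem_scal : forall (E : banach s) (a : field_of s) (x : nat -> E),
    seq_mem x -> seq_mem (fun j => scal a (x j));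
  seq_norm_triangle : forall (E : banach s) (x y : nat -> E), seq_mem x -> seq_mem y ->
    seq_norm (fun j => plus (x j) (y j)) <= seq_norm x + seq_norm y;
  seq_norm_scal : forall (E : banach s) (a : field_of s) (x : nat -> E), seq_mem x ->
    seq_norm (fun j => scal a (x j)) = abs a * seq_norm x;
  seq_norm_complete : forall (E : banach s) (u : nat -> nat -> E),
    (forall m, seq_mem (u m)) ->
    (forall eps : posreal, exists N : nat, forall p q : nat,
      (N <= p)%nat -> (N <= q)%nat ->
      seq_norm (fun j => minus (u p j) (u q j)) < eps) ->
    exists x : nat -> E, seq_mem x /\
      is_lim_seq (fun m => seq_norm (fun j => minus (u m j) (x j))) 0;
  seq_mem_c00 : forall (E : banach s) (x : nat -> E), c00 x -> seq_mem x;
  seq_mem_linf : forall (E : banach s) (x : nat -> E), seq_mem x -> linf x;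
  seq_norm_linf : forall (E : banach s) (x : nat -> E), seq_mem x ->
    Rbar_le (linf_norm x) (seq_norm x);
  seq_norm_unit_seq : forall j : nat, seq_norm (unit_seq s j) = 1
}.

Arguments seq_mem {s} X {E} x : rename.
Arguments seq_norm {s} X {E} x : rename.

Section Operators.
Variables (s : scalars) (n : nat).
Variables (E : 'I_n -> banach s) (F : banach s).
Implicit Type A : (forall i, E i) -> F.

Definition multilinear A : Prop :=
  forall (i : 'I_n) (x : forall i, E i) (a : field_of s) (u v : E i),
    A (dfwith x (plus (scal a u) v)) =
    plus (scal a (A (dfwith x u))) (A (dfwith x v)).

(* Continuity for the product topology: [E] has finitely many factors. *)
Definition mcontinuous A : Prop :=
  forall (x : forall i, E i) (eps : posreal), exists delta : posreal,
    forall y : forall i, E i,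
      (forall i, ball (x i) delta (y i)) -> ball (A x) eps (A y).

Definition operator A : Prop := multilinear A /\ mcontinuous A.

Definition op_norm A : Rbar :=
  Lub_Rbar (fun r => exists x : forall i, E i,
    (forall i, norm (x i) <= 1) /\ r = norm (A x)).

Definition induced A (x : forall i, nat -> E i) : nat -> F :=
  fun j => A (fun i => x i j).

Definition summing (X : 'I_n -> seq_class s) (Y : seq_class s) A : Prop :=
  operator A /\
  forall x : forall i, nat -> E i,
    (forall i, seq_mem (X i) (x i)) -> seq_mem Y (induced A x).

Definition summing_norm (X : 'I_n -> seq_class s) (Y : seq_class s) A : Rbar :=
  Lub_Rbar (fun r => exists x : forall i, nat -> E i,
    (forall i, seq_mem (X i) (x i) /\ seq_norm (X i) (x i) <= 1) /\
    r = seq_norm Y (induced A x)).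

End Operators.

Section Properties.
Variable s : scalars.
Implicit Types X Y : seq_class s.

(* Linear operators from E to F are the n-linear ones for n = 1. *)
Definition linearly_stable X : Prop :=
  forall (E F : banach s) (A : ('I_1 -> E) -> F),
    (summing (E := fun _ => E) (fun _ => X) X A <->
     operator (E := fun _ => E) A) /\
    (operator (E := fun _ => E) A ->
     summing_norm (E := fun _ => E) (fun _ => X) X A =
     op_norm (E := fun _ => E) A).

Definition scalar_compatible (n : nat) (X : 'I_n -> seq_class s) Y : Prop :=
  forall l : 'I_n -> nat -> scalar_space s,
    (forall i, seq_mem (X i) (l i)) ->
    let p : nat -> scalar_space s :=
      fun j => \big[@mult (field_of s)/one]_(i < n) l i j in
    seq_mem Y p /\ seq_norm Y p <= \big[Rmult/1]_(i < n) seq_norm (X i) (l i).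

Definition finitely_determined X : Prop :=
  forall (E : banach s) (x : nat -> E),
    let S := Sup_seq (fun k => Finite (seq_norm X (seq_trunc x k.+1))) in
    (seq_mem X x <-> Rbar_lt S p_infty) /\ (seq_mem X x -> Finite (seq_norm X x) = S).

Definition finitely_shrinking X : Prop :=
  forall (E : banach s) (x : nat -> E) (k : nat), seq_mem X x ->
    seq_mem X (seq_omit x k) /\ seq_norm X (seq_omit x k) <= seq_norm X x.

(* X^u, meant for finitely shrinking X, for which the tails are in X(E). *)
Definition seq_mem_u X (E : banach s) (x : nat -> E) : Prop :=
  seq_mem X x /\ is_lim_seq (fun m => seq_norm X (seq_tail x m)) 0.

Definition seq_incl (P Q : forall E : banach s, (nat -> E) -> Prop) : Prop :=
  forall (E : banach s) (x : nat -> E), P E x -> Q E x.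

Definition fin_le X Y : Prop :=
  forall (E : banach s) (x : nat -> E), c00 x -> seq_norm X x <= seq_norm Y x.

End Properties.

(* Main.v *)
Require Import Defs.
From mathcomp Require Import all_boot.
From Stdlib Require Import Reals Lra FunctionalExtensionality ClassicalEpsilon.
From Coquelicot Require Import Coquelicot.

(** The heart of the matter is that a summing operator [A], although summability
    only speaks of membership, satisfies norm bounds: [induced A] is bounded on
    products of balls ([induced_bounded]).

    Given these bounds, let [A] be [(X_1,...,X_n;Y)]-summing and [x^i] in
    [Z(E_i)].  All truncations of the [x^i] are finitely supported, so their
    [X_i]-norms are at most their [Z]-norms, which stay below that of [x^i]
    since [Z] is finitely determined.  Hence the [Y]-norms of the truncations of
    [A(x_j^1,...,x_j^n)] are bounded; so are their [W]-norms because
    [W <= Y] on finitely supported sequences, and [W] being finitely determined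
    puts the whole sequence in [W(F)].
    Conversely, let [A] be [(Z,...,Z;W)]-summing and [x^i] in [X_i(E_i)].  The
    image is in [W(F)].  The tails of the [x^i] remain bounded in [Z], those of
    [x^k] tend to [0], and the bound is linear in the [k]-th sequence, so the
    tails of the image tend to [0] in [W(F)]: the image is in [W^u(F)], which
    lies in [Y(F)].

    The bound itself is a closed graph theorem for multilinear maps.  Joint
    boundedness is reached by freeing one argument after the other; when an
    argument [v] is freed, the others range over a bounded set, and one needs a
    bound uniform over that set.  This is [uniform_closed_graph]: a pointwise
    bounded family of linear maps with closed graphs between Banach spaces is
    uniformly bounded.  It merges the uniform boundedness principle and the
    closed graph theorem, and both follow from Baire's theorem by the argument
    of Zabreiko's lemma for the seminorm [sup_i |T_i v|].  The graphs are closed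
    because norm convergence in a sequence class forces convergence of each
    coordinate, and [A] is continuous. *)

Set Implicit Arguments.
Unset Strict Implicit.
Unset Printing Implicit Defensive.

Local Open Scope R_scope.

(** * Auxiliary facts on limits, groups and scalars *)

Lemma is_lim_seq_squeeze0 (u v : nat -> R) : (forall k, 0 <= u k <= v k) ->
  is_lim_seq v 0 -> is_lim_seq u 0.
Proof.
move=> uv v0; apply: (is_lim_seq_le_le (fun _ => 0) _ v) => //.
exact: is_lim_seq_const.
Qed.

Lemma is_lim_seq_scal0 (c : R) (u : nat -> R) :
  is_lim_seq u 0 -> is_lim_seq (fun k => c * u k) 0.
Proof.
move=> u0; have -> : Finite 0 = Rbar_mult c 0 by rewrite /= Rmult_0_r.
exact: is_lim_seq_scal_l.
Qed.

Lemma is_lim_seq_geom_half (c : R) : is_lim_seq (fun k => c * (/ 2) ^ k) 0.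
Proof.
by apply/is_lim_seq_scal0/is_lim_seq_geom; rewrite Rabs_pos_eq; lra.
Qed.

Lemma halving_lim (r : nat -> R) : (forall k, 0 <= r k) ->
  (forall k, r k.+1 <= r k / 2) -> is_lim_seq r 0.
Proof.
move=> r0 half; apply: is_lim_seq_squeeze0 (is_lim_seq_geom_half (r 0%nat)) => k.
split=> //; elim: k => [|k IHk] /=; first by lra.
by have := half k; lra.
Qed.

Section GroupIdentities.
Variable G : AbelianGroup.
Implicit Types a b c d : G.

Lemma minusACA a b c d :
  minus (minus a b) (minus c d) = minus (minus a c) (minus b d).
Proof.
rewrite /minus !opp_plus !opp_opp -!plus_assoc; congr plus.
by rewrite !plus_assoc (plus_comm (opp b)).
Qed.

Lemma minus_plusr a b c : minus a (plus b c) = minus (minus a b) c.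
Proof. by rewrite /minus opp_plus plus_assoc. Qed.

Lemma plus_minusKl a b : minus (plus a b) a = b.
Proof. by rewrite (plus_comm a) /minus -plus_assoc plus_opp_r plus_zero_r. Qed.

Lemma minus_eq0 a b : minus a b = zero -> a = b.
Proof.
move=> ab0; rewrite -(plus_zero_l b) -ab0 /minus -plus_assoc.
by rewrite plus_opp_l plus_zero_r.
Qed.

End GroupIdentities.

(** Rescaling in a space over either field by a positive real; the inverse [b]
    comes along because [field_of s] is only known to be a ring. *)
Lemma real_scalar (s : scalars) (t : R) : 0 < t ->
  exists a b : field_of s, [/\ mult a b = one, abs a = t & abs b = / t].
Proof.
move=> t0; have t_neq : t <> 0 by lra.
have it0 := Rinv_0_lt_compat _ t0.
case: s => /=.
  exists t, (/ t); split; first by apply: Rinv_r.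
    by apply: Rabs_pos_eq; lra.
  by apply: Rabs_pos_eq; lra.
exists (RtoC t), (RtoC (/ t)); split.
- change (Cmult t (/ t)%R = RtoC 1).
  by rewrite -RtoC_mult Rinv_r.
- change (Cmod t = t); rewrite Cmod_R; apply: Rabs_pos_eq; lra.
- change (Cmod (/ t)%R = / t); rewrite Cmod_R; apply: Rabs_pos_eq; lra.
Qed.

(** * The Banach space of sequences X(E) *)

Section SequenceSpace.
Variables (s : scalars) (X : seq_class s) (E : banach s).
Implicit Types (u v w x y : nat -> E).

Definition seq_dist u v : R := seq_norm X (fun j => minus (u j) (v j)).

Lemma seq_mem_opp x : seq_mem X x -> seq_mem X (fun j => opp (x j)).
Proof.
move=> Xx; have := seq_mem_scal (opp one) Xx; congr seq_mem.
by apply: functional_extensionality => j; rewrite scal_opp_one.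
Qed.

Lemma seq_mem_minus x y :
  seq_mem X x -> seq_mem X y -> seq_mem X (fun j => minus (x j) (y j)).
Proof. by move=> Xx Xy; apply: (seq_mem_plus Xx); apply: seq_mem_opp. Qed.

Lemma seq_mem_zero : seq_mem X (fun _ => zero : E).
Proof. by apply: seq_mem_c00; exists 0%nat. Qed.

Lemma norm_le_seq_norm x j : seq_mem X x -> norm (x j) <= seq_norm X x.
Proof.
move=> Xx; have := seq_norm_linf Xx; rewrite /linf_norm => le_sup.
have : Rbar_le (norm (x j)) (seq_norm X x) => //.
apply: Rbar_le_trans le_sup.
by apply: (Sup_seq_minor_le (fun j => Finite (norm (x j))) _ j) => /=; lra.
Qed.

Lemma seq_norm_ge0 x : seq_mem X x -> 0 <= seq_norm X x.
Proof.
by move=> Xx; apply: Rle_trans (norm_le_seq_norm 0%nat Xx); apply: norm_ge_0.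
Qed.

Lemma seq_norm_opp x : seq_mem X x ->
  seq_norm X (fun j => opp (x j)) = seq_norm X x.
Proof.
move=> Xx; have := seq_norm_scal (opp one) Xx.
rewrite abs_opp_one Rmult_1_l => <-; congr seq_norm.
by apply: functional_extensionality => j; rewrite scal_opp_one.
Qed.

Lemma seq_norm_minus x y : seq_mem X x -> seq_mem X y ->
  seq_norm X (fun j => minus (x j) (y j)) <= seq_norm X x + seq_norm X y.
Proof.
move=> Xx Xy; rewrite -(seq_norm_opp Xy).
exact: (seq_norm_triangle Xx (seq_mem_opp Xy)).
Qed.

Lemma seq_dist_ge0 x y : seq_mem X x -> seq_mem X y -> 0 <= seq_dist x y.
Proof. by move=> Xx Xy; apply: seq_norm_ge0; apply: seq_mem_minus. Qed.

Lemma seq_dist_sym x y :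
  seq_mem X x -> seq_mem X y -> seq_dist x y = seq_dist y x.
Proof.
move=> Xx Xy; rewrite /seq_dist -seq_norm_opp; last exact: seq_mem_minus.
by congr seq_norm; apply: functional_extensionality => j; rewrite opp_minus.
Qed.

Lemma seq_dist_triangle x y z : seq_mem X x -> seq_mem X y -> seq_mem X z ->
  seq_dist x z <= seq_dist x y + seq_dist y z.
Proof.
move=> Xx Xy Xz.
have := seq_norm_triangle (seq_mem_minus Xx Xy) (seq_mem_minus Xy Xz).
congr Rle; congr seq_norm; apply: functional_extensionality => j.
by rewrite -minus_trans.
Qed.

Lemma seq_dist_diag x : seq_mem X x -> seq_dist x x = 0.
Proof.
move=> Xx; have := seq_norm_scal zero Xx; rewrite abs_zero Rmult_0_l => <-.
congr seq_norm; apply: functional_extensionality => j.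
by rewrite minus_eq_zero; rewrite (@scal_zero_l _ E).
Qed.

Lemma seq_dist_0r x : seq_dist x (fun _ => zero) = seq_norm X x.
Proof.
by congr seq_norm; apply: functional_extensionality => j; rewrite minus_zero_r.
Qed.

Lemma seq_dist_0l x : seq_mem X x -> seq_dist (fun _ => zero) x = seq_norm X x.
Proof.
by move=> Xx; rewrite seq_dist_sym ?seq_dist_0r //; apply: seq_mem_zero.
Qed.

(** The centres form a Cauchy sequence, and its limit stays in every ball
    because the inequality on centres and radii says that each closed ball
    contains the next one.  It serves for Baire's theorem, and with the radii
    [2 c / 2^k] it sums series whose terms have norm at most [c / 2^k]. *)
Lemma nested_balls (u : nat -> nat -> E) (r : nat -> R) :
  (forall k, seq_mem X (u k)) -> (forall k, 0 <= r k) ->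
  (forall k, r k.+1 <= r k / 2) ->
  (forall k, seq_dist (u k) (u k.+1) + r k.+1 <= r k) ->
  exists x, seq_mem X x /\ forall k, seq_dist (u k) x <= r k.
Proof.
move=> Xu r0 half nest.
have r_lim := halving_lim r0 half.
have close p d : seq_dist (u p) (u (p + d)%nat) + r (p + d)%nat <= r p.
  elim: d => [|d IHd].
    by rewrite addn0 seq_dist_diag //; lra.
  rewrite addnS; have := nest (p + d)%nat.
  by have := seq_dist_triangle (Xu p) (Xu (p + d)%nat) (Xu (p + d).+1); lra.
have close_le p q : (p <= q)%nat -> seq_dist (u p) (u q) <= r p.
  move=> /subnKC <-; have := close p (q - p)%nat.
  by have := r0 (p + (q - p))%nat; lra.
have [||x [Xx x_lim]] := @seq_norm_complete s X E u => //.
  move=> eps.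
  have eps2 : 0 < eps / 2 by have := cond_pos eps; lra.
  have /is_lim_seq_spec /= /(_ (mkposreal _ eps2)) [N rN] := r_lim.
  have {}rN : r N < eps / 2.
    by move: (rN N (le_n N)) => /=; rewrite Rminus_0_r Rabs_pos_eq.
  exists N => p q Np Nq; change (seq_dist (u p) (u q) < eps).
  have := seq_dist_triangle (Xu p) (Xu N) (Xu q).
  rewrite (seq_dist_sym (Xu p) (Xu N)).
  by have := close_le _ _ Np; have := close_le _ _ Nq; lra.
exists x; split=> // k.
have : Rbar_le (seq_dist (u k) x) (r k + 0) => [|/=]; last by lra.
apply: (is_lim_seq_le_loc (fun _ => seq_dist (u k) x)
          (fun q => r k + seq_dist (u q) x)).
- exists k => q /leP kq; have := close_le _ _ kq.
  by have := seq_dist_triangle (Xu k) (Xu q) Xx; lra.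
- exact: is_lim_seq_const.
- by apply: is_lim_seq_plus'; [apply: is_lim_seq_const | apply: x_lim].
Qed.

(** Baire's theorem: of countably many sets covering the space, one is dense in
    some ball.  Otherwise every ball contains, for every [m], a smaller ball
    that avoids [P m], and a point common to a nested sequence of balls, the
    [m]-th avoiding [P m], would be left uncovered. *)
Lemma baire (P : nat -> (nat -> E) -> Prop) :
  (forall v, seq_mem X v -> exists m, P m v) ->
  exists m w r, [/\ seq_mem X w, 0 < r &
    forall v, seq_mem X v -> seq_dist w v <= r ->
    forall eps, 0 < eps ->
      exists u, [/\ seq_mem X u, seq_dist v u <= eps & P m u]].
Proof.
move=> cover; apply: NNPP => nodense.
pose ok (b : (nat -> E) * R) := seq_mem X b.1 /\ 0 < b.2.
have step (mb : nat * ((nat -> E) * R)) : exists b', ok mb.2 ->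
    [/\ ok b', b'.2 <= mb.2.2 / 2, seq_dist mb.2.1 b'.1 + b'.2 <= mb.2.2 &
      forall u, seq_mem X u -> seq_dist b'.1 u <= b'.2 -> ~ P mb.1 u].
  case: mb => m [w r] /=.
  have [[Xw r0]|] := classic (ok (w, r)); last by exists (w, r).
  (* Half the radius leaves room for a ball around [v] inside the given one. *)
  apply: NNPP => nob; apply: nodense; exists m, w, (r / 2).
  rewrite /= in Xw r0; split=> // [|v Xv wv eps eps0]; first by lra.
  apply: NNPP => nou; apply: nob; exists (v, Rmin eps (r / 2)) => _ /=.
  have := Rmin_l eps (r / 2); have := Rmin_r eps (r / 2) => r'r r'eps.
  split=> [||| u Xu vu Pu]; try lra.
    by split=> //=; apply: Rmin_pos; lra.
  by apply: nou; exists u; split=> //; lra.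
have [f fP] := choice _ step.
have [m Pm0] := cover _ seq_mem_zero.
pose b := fix b k := if k is k'.+1 then f (k', b k') else (fun _ => zero : E, 1).
have b_ok k : ok (b k).
  elim: k => [|k IHk]; first by split; [apply: seq_mem_zero | rewrite /=; lra].
  by have [] := fP (k, b k) IHk.
have [||||x [Xx bx]] :=
  nested_balls (u := fun k => (b k).1) (r := fun k => (b k).2).
- by move=> k; case: (b_ok k).
- by move=> k; case: (b_ok k) => _ ?; lra.
- by move=> k; have [_] := fP (k, b k) (b_ok k).
- by move=> k; have [_ _] := fP (k, b k) (b_ok k).
have [k Pkx] := cover _ Xx.
have [_ _ _ /(_ x Xx (bx k.+1))] := fP (k, b k) (b_ok k).
exact.
Qed.

End SequenceSpace.

(** * A closed graph theorem for pointwise bounded families *)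

Section UniformClosedGraph.
Variables (s : scalars) (X Y : seq_class s) (E F : banach s) (I : Type).
Variable T : I -> (nat -> E) -> nat -> F.

Hypothesis T_mem : forall i v, seq_mem X v -> seq_mem Y (T i v).
Hypothesis T_lin : forall i a u v, seq_mem X u -> seq_mem X v ->
  T i (fun j => plus (scal a (u j)) (v j)) =
  fun j => plus (scal a (T i u j)) (T i v j).
(* Continuity of the coordinates of [T i]; it makes the graph of [T i] closed. *)
Hypothesis T_cont : forall i (u : nat -> nat -> E) v,
  (forall k, seq_mem X (u k)) -> seq_mem X v ->
  is_lim_seq (fun k => seq_dist X (u k) v) 0 ->
  forall j, is_lim_seq (fun k => norm (minus (T i (u k) j) (T i v j))) 0.
Hypothesis T_bounded : forall v, seq_mem X v ->
  exists c, forall i, seq_norm Y (T i v) <= c.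

(** Says that the seminorm [sup_i |T_i v|] is at most [c], without forming the
    supremum. *)
Definition family_le c v := forall i, seq_norm Y (T i v) <= c.

Lemma family_zero i : T i (fun _ => zero) = fun _ => zero.
Proof.
have X0 := seq_mem_zero X E.
have := T_lin i (opp one) X0 X0.
have -> : (fun _ : nat => plus (scal (opp one) zero) zero) = (fun _ => zero : E).
  by apply: functional_extensionality => j; rewrite scal_opp_one plus_opp_l.
move=> ->; apply: functional_extensionality => j.
by rewrite scal_opp_one plus_opp_l.
Qed.

Lemma family_scal i a v : seq_mem X v ->
  T i (fun j => scal a (v j)) = fun j => scal a (T i v j).
Proof.
move=> Xv; have := T_lin i a Xv (seq_mem_zero X E).
rewrite family_zero.
have -> : (fun j => plus (scal a (v j)) zero) = (fun j => scal a (v j)).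
  by apply: functional_extensionality => j; rewrite plus_zero_r.
by move=> ->; apply: functional_extensionality => j; rewrite plus_zero_r.
Qed.

Lemma family_minus i u v : seq_mem X u -> seq_mem X v ->
  T i (fun j => minus (u j) (v j)) = fun j => minus (T i u j) (T i v j).
Proof.
move=> Xu Xv; have := T_lin i (opp one) Xv Xu.
have -> : (fun j => plus (scal (opp one) (v j)) (u j)) =
          (fun j => minus (u j) (v j)).
  by apply: functional_extensionality => j; rewrite scal_opp_one plus_comm.
move=> ->; apply: functional_extensionality => j.
by rewrite scal_opp_one plus_comm.
Qed.

(** By Baire's theorem the vectors with seminorm at most some [m] are dense in a
    ball.  The ball is moved to the origin by writing a small [h] as
    [(w + h) - w] and approximating both terms, then rescaled to radius [d]. *)
Lemma bounded_approximation : exists C, 0 <= C /\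
  forall h d eps, seq_mem X h -> 0 < d -> seq_norm X h <= d -> 0 < eps ->
  exists u, [/\ seq_mem X u, seq_dist X h u <= eps & family_le (C * d) u].
Proof.
have [v Xv|m [w [r [Xw r0 dense]]]] := @baire s X E (fun m => family_le (INR m)).
  have [c cP] := T_bounded Xv.
  have [m cm] := INR_unbounded c.
  by exists m => i; have := cP i; lra.
have ir0 := Rinv_0_lt_compat _ r0; have m0 := pos_INR m.
exists (2 * INR m / r); split=> [|h d eps Xh d0 hd eps0].
  by apply: Rmult_le_pos; lra.
have id0 := Rinv_0_lt_compat _ d0.
have t0 : 0 < d / r by apply: Rmult_lt_0_compat.
have [a [b [ab absa absb]]] := real_scalar s t0.
pose h' j := scal b (h j).
have Xh' : seq_mem X h' by apply: seq_mem_scal.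
have nh' : seq_norm X h' <= r.
  rewrite seq_norm_scal // absb.
  have {2}-> : r = / (d / r) * d by field; lra.
  by apply: Rmult_le_compat_l; [apply/Rlt_le/Rinv_0_lt_compat | ].
(* Half of the error allowed before the scaling by [d / r], for each of the
   two approximations. *)
pose e := eps / (d / r) / 2.
have it0 := Rinv_0_lt_compat _ t0.
have e0 : 0 < e by apply: Rmult_lt_0_compat; [apply: Rmult_lt_0_compat|]; lra.
have Xwh : seq_mem X (fun j => plus (w j) (h' j)) by apply: seq_mem_plus.
have [|u1 [Xu1 u1P Tu1]] := dense _ Xwh _ e e0.
  rewrite seq_dist_sym //; move: nh'; congr Rle; congr seq_norm.
  by apply: functional_extensionality => j; rewrite plus_minusKl.
have [|u2 [Xu2 u2P Tu2]] := dense _ Xw _ e e0.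
  by rewrite seq_dist_diag //; lra.
pose u j := minus (u1 j) (u2 j).
have Xu : seq_mem X u by apply: seq_mem_minus.
exists (fun j => scal a (u j)); split; first exact: seq_mem_scal.
  have -> : seq_dist X h (fun j => scal a (u j)) = d / r * seq_dist X h' u.
    rewrite -absa -seq_norm_scal; last exact: seq_mem_minus.
    congr seq_norm; apply: functional_extensionality => j.
    have -> : h j = scal a (h' j).
      by rewrite /h' (@scal_assoc _ E) ab (@scal_one _ E).
    by rewrite -(@scal_minus_distr_l _ E).
  have : seq_dist X h' u <= e + e.
    have := seq_norm_minus (seq_mem_minus Xwh Xu1) (seq_mem_minus Xw Xu2).
    rewrite -!/(seq_dist _ _ _) => H.
    apply: Rle_trans (Rplus_le_compat _ _ _ _ u1P u2P); move: H.
    congr Rle; congr seq_norm; apply: functional_extensionality => j.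
    by rewrite minusACA plus_minusKl.
  move=> /(Rmult_le_compat_l (d / r)) H; have {}H := H (Rlt_le _ _ t0).
  by apply: Rle_trans H _; apply: Req_le; rewrite /e; field; lra.
move=> i; rewrite family_scal // seq_norm_scal; last exact: T_mem.
rewrite absa /u family_minus //.
have := seq_norm_minus (T_mem i Xu1) (T_mem i Xu2).
have := Tu1 i; have := Tu2 i => H1 H2 H3.
have -> : 2 * INR m / r * d = d / r * (INR m + INR m) by field; lra.
by apply: Rmult_le_compat_l; lra.
Qed.

(** The seminorm [sup_i |T_i v|] is countably subadditive, which is where the
    closed graphs and the completeness of [Y(F)] enter: with [u k] the partial
    sums of a series for [v], the [T i (u k)] converge in [Y(F)], and their limit
    is [T i v] since it has the same coordinates. *)
Lemma countable_subadditivity c u v : 0 <= c ->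
  (forall k, seq_mem X (u k)) -> seq_mem X v -> u 0%nat = (fun _ => zero) ->
  is_lim_seq (fun k => seq_dist X (u k) v) 0 ->
  (forall k, family_le (c * (/ 2) ^ k) (fun j => minus (u k.+1 j) (u k j))) ->
  family_le (2 * c) v.
Proof.
move=> c0 Xu Xv u0 uv ub i.
have YT k : seq_mem Y (T i (u k)) by apply: T_mem.
have half0 k : 0 < (/ 2) ^ k by apply: pow_lt; lra.
have [|k|k|k|z [Yz Tz]] :=
    nested_balls (X := Y) (u := fun k => T i (u k))
                 (r := fun k => 2 * c * (/ 2) ^ k).
- by [].
- by apply: Rmult_le_pos; [lra | apply: Rlt_le].
- by rewrite /=; lra.
- have := ub k i; rewrite family_minus // seq_dist_sym // => H /=.
  by rewrite /seq_dist; lra.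
have Tvz : T i v = z.
  apply: functional_extensionality => j.
  have zlim : is_lim_seq (fun k => norm (minus (T i (u k) j) (z j))) 0.
    apply: is_lim_seq_squeeze0 (is_lim_seq_geom_half (2 * c)) => k.
    split; first exact: norm_ge_0.
    apply: Rle_trans (Tz k).
    exact: (norm_le_seq_norm j (seq_mem_minus (YT k) Yz)).
  have Tlim := T_cont i Xu Xv uv j.
  have /(Rle_antisym) H : norm (minus (T i v j) (z j)) <= 0.
    have : Rbar_le (norm (minus (T i v j) (z j))) (0 + 0) => [|/=]; last by lra.
    apply: (is_lim_seq_le (fun _ => norm (minus (T i v j) (z j)))); last first.
    - exact: is_lim_seq_plus' Tlim zlim.
    - exact: is_lim_seq_const.
    move=> k /=; rewrite (minus_trans (T i (u k) j)).
    apply: Rle_trans (norm_triangle _ _) _.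
    by rewrite -opp_minus norm_opp; lra.
  exact/minus_eq0/norm_eq_zero/H/norm_ge_0.
(* As [T i (u 0) = 0], the first radius bounds the norm of the limit. *)
rewrite Tvz; have := Tz 0%nat.
by rewrite u0 family_zero seq_dist_0l //= Rmult_1_r.
Qed.

(** Zabreiko's argument: [v] is the sum of a series of successive approximations
    of what remains, whose terms are geometrically small for the seminorm by
    [bounded_approximation]. *)
Lemma uniform_closed_graph : exists C, 0 <= C /\
  forall i v, seq_mem X v -> seq_norm Y (T i v) <= C * seq_norm X v.
Proof.
have [C [C0 approx]] := bounded_approximation.
exists (2 * C); split=> [|i v Xv]; first by lra.
(* A radius slightly above the norm of [v] is used as that norm may vanish. *)
suff bnd d : 0 < d -> seq_norm X v <= d -> family_le (2 * (C * d)) v.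
  have Xv0 := seq_norm_ge0 Xv.
  apply: Rle_plus_epsilon => eps eps0.
  have C1 : 0 < 2 * C + 1 by lra.
  have iC1 := Rinv_0_lt_compat _ C1.
  have e0 : 0 < eps / (2 * C + 1) by apply: Rmult_lt_0_compat.
  apply: Rle_trans (bnd (seq_norm X v + eps / (2 * C + 1)) _ _ i) _; try lra.
  have : (2 * C + 1) * (eps / (2 * C + 1)) = eps by field; lra.
  by lra.
move=> d0 vd.
pose rad k := d * (/ 2) ^ k.
have rad0 k : 0 < rad k by apply: Rmult_lt_0_compat => //; apply: pow_lt; lra.
pose ok k (w : nat -> E) := seq_mem X w /\ seq_dist X v w <= rad k.
have step (kw : nat * (nat -> E)) : exists w', ok kw.1 kw.2 ->
    ok kw.1.+1 w' /\
    family_le (C * d * (/ 2) ^ kw.1) (fun j => minus (w' j) (kw.2 j)).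
  case: kw => k w /=.
  have [[Xw vw]|] := classic (ok k w); last by exists w.
  have [u [Xu du bu]] :=
    approx _ _ _ (seq_mem_minus Xv Xw) (rad0 k) vw (rad0 k.+1).
  exists (fun j => plus (w j) (u j)) => _; split.
    split; first exact: seq_mem_plus.
    move: du; congr Rle; congr seq_norm.
    by apply: functional_extensionality => j; rewrite minus_plusr.
  have -> : (fun j => minus (plus (w j) (u j)) (w j)) = u.
    by apply: functional_extensionality => j; rewrite plus_minusKl.
  by rewrite Rmult_assoc.
have [f fP] := choice _ step.
pose u := fix u k := if k is k'.+1 then f (k', u k') else (fun _ => zero : E).
have u_ok k : ok k (u k).
  elim: k => [|k IHk]; last by have [] := fP (k, u k) IHk.
  split; first exact: seq_mem_zero.
  by rewrite seq_dist_0r /rad /= Rmult_1_r.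
apply: (countable_subadditivity (u := u)) => //.
- by apply: Rmult_le_pos; lra.
- by move=> k; case: (u_ok k).
- apply: is_lim_seq_squeeze0 (is_lim_seq_geom_half d) => k.
  have [Xuk vuk] := u_ok k.
  by split; [apply: seq_dist_ge0 | rewrite seq_dist_sym].
- by move=> k; have [] := fP (k, u k) (u_ok k).
Qed.

End UniformClosedGraph.

(** * Boundedness of the operator induced by a summing operator *)

Lemma dfwith_id (I : eqType) (T : I -> Type) (f : forall i, T i) (k : I) :
  dfwith f (f k) = f.
Proof. by apply: functional_extensionality_dep => i; case: dfwithP. Qed.

Section MultilinearBounds.
Variables (s : scalars) (n : nat) (X : 'I_n -> seq_class s) (Y : seq_class s).
Variables (E : 'I_n -> banach s) (F : banach s) (A : (forall i, E i) -> F).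
Hypothesis sumA : summing X Y A.

Definition all_mem (x : forall i, nat -> E i) := forall i, seq_mem (X i) (x i).

Lemma induced_dfwith (y : forall i, nat -> E i) k (v : nat -> E k) j :
  induced A (dfwith y v) j = A (dfwith (fun i => y i j) (v j)).
Proof.
congr A; apply: functional_extensionality_dep => i.
by case: dfwithP => [|i' ki']; rewrite ?dfwith_in ?dfwith_out.
Qed.

Lemma all_mem_dfwith y k (v : nat -> E k) :
  all_mem y -> seq_mem (X k) v -> all_mem (dfwith y v).
Proof. by move=> Xy Xv i; case: dfwithP. Qed.

Lemma operator_slot_continuous (x : forall i, E i) k (u : nat -> E k) (v : E k) :
  is_lim_seq (fun p => norm (minus (u p) v)) 0 ->
  is_lim_seq (fun p => norm (minus (A (dfwith x (u p))) (A (dfwith x v)))) 0.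
Proof.
move=> /is_lim_seq_spec uv; apply/is_lim_seq_spec => eps /=.
have nf := @norm_factor_gt_0 _ F; have inf := Rinv_0_lt_compat _ nf.
have e0 : 0 < eps / @norm_factor _ F.
  by apply: Rmult_lt_0_compat => //; apply: cond_pos.
have [_ /(_ (dfwith x v) (mkposreal _ e0)) [d dP]] := sumA.1.
have [N NP] := uv d; exists N => p Np; have := NP p Np.
rewrite !Rminus_0_r !Rabs_pos_eq; try exact: norm_ge_0.
move=> upv; have := norm_compat2 _ _ _ (dP (dfwith x (u p)) _) => /=.
have -> : @norm_factor _ F * (eps / @norm_factor _ F) = eps by field; lra.
apply=> i; case: (eqVneq k i) => [<-|ki]; last first.
  by rewrite !dfwith_out //; apply: ball_center.
by rewrite !dfwith_in; apply: norm_compat1.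
Qed.

(** [uniform_closed_graph] for the [k]-th argument, the family being indexed by
    the values [y] of the other ones; [y k] is overwritten. *)
Lemma slot_bound k (D : (forall i, nat -> E i) -> Prop) :
  (forall y, D y -> all_mem y) ->
  (forall v : nat -> E k, seq_mem (X k) v -> exists c, forall y, D y ->
     seq_norm Y (induced A (dfwith y v)) <= c) ->
  exists C, 0 <= C /\ forall y (v : nat -> E k), D y -> seq_mem (X k) v ->
    seq_norm Y (induced A (dfwith y v)) <= C * seq_norm (X k) v.
Proof.
move=> Dm bnd.
have [||||C [C0 CP]] := @uniform_closed_graph s (X k) Y (E k) F
    {y | D y} (fun y v => induced A (dfwith (proj1_sig y) v)).
- by move=> [y Dy] v Xv; apply: sumA.2; apply: all_mem_dfwith => //; apply: Dm.
- move=> [y Dy] a u v Xu Xv /=; apply: functional_extensionality => j.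
  by rewrite !induced_dfwith sumA.1.1.
- move=> [y Dy] u v Xu Xv uv j /=.
  pose yj i := y i j.
  apply: (is_lim_seq_ext
    (fun p => norm (minus (A (dfwith yj (u p j))) (A (dfwith yj (v j)))))).
    by move=> p; rewrite !induced_dfwith.
  apply: operator_slot_continuous.
  apply: is_lim_seq_squeeze0 uv => p; split; first exact: norm_ge_0.
  exact: (norm_le_seq_norm j (seq_mem_minus (Xu p) Xv)).
- move=> v /bnd [c cP]; exists c => -[y Dy]; exact: cP.
by exists C; split=> // y v Dy Xv; apply: (CP (exist _ y Dy)).
Qed.

(** The first [m] arguments range over balls and the others are fixed, with a
    constant that may depend on them; going from [m] to [m.+1], the induction
    hypothesis, used for each value of the argument to be freed, is the
    pointwise boundedness that [slot_bound] asks for. *)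
Lemma partial_bound (M : R) (m : nat) : (m <= n)%nat ->
  forall x, all_mem x -> exists C, forall y, all_mem y ->
    (forall i : 'I_n, (i < m)%nat -> seq_norm (X i) (y i) <= M) ->
    (forall i : 'I_n, (m <= i)%nat -> y i = x i) ->
    seq_norm Y (induced A y) <= C.
Proof.
elim: m => [|m IHm] mn x Xx.
  exists (seq_norm Y (induced A x)) => y Xy _ yx.
  have -> : y = x by apply: functional_extensionality_dep => i; apply: yx.
  exact: Rle_refl.
pose k := Ordinal mn.
pose D (y : forall i, nat -> E i) := [/\ all_mem y,
  forall i : 'I_n, (i < m)%nat -> seq_norm (X i) (y i) <= M &
  forall i : 'I_n, (m < i)%nat -> y i = x i].
have [|v Xv|C [C0 CP]] := slot_bound (k := k) (D := D).
- by move=> y [].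
- have [C CP] := IHm (ltnW mn) _ (all_mem_dfwith Xx Xv).
  exists C => y [Xy yM yx]; apply: CP; first exact: all_mem_dfwith.
    move=> i im; rewrite dfwith_out; first exact: yM.
    by rewrite -val_eqE /= gtn_eqF.
  move=> i; rewrite leq_eqVlt => mi; case: (eqVneq k i) => [<-|ki].
    by rewrite !dfwith_in.
  case/orP: mi => [/eqP mi|mi]; first by case/eqP: ki; apply: val_inj.
  by rewrite !dfwith_out //; apply: yx.
exists (C * M) => y Xy yM yx; rewrite -(dfwith_id y k).
apply: Rle_trans (CP _ _ _ (Xy k)) _.
  by split=> // i im; apply: yM; apply: ltnW.
by apply: Rmult_le_compat_l => //; apply: yM => /=.
Qed.

Lemma induced_bounded (M : R) : exists C, forall y, all_mem y ->
  (forall i, seq_norm (X i) (y i) <= M) -> seq_norm Y (induced A y) <= C.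
Proof.
have X0 : all_mem (fun i _ => zero) by move=> i; apply: seq_mem_zero.
have [C CP] := partial_bound M (leqnn n) X0.
by exists C => y Xy yM; apply: CP => // i; rewrite leqNgt ltn_ord.
Qed.

End MultilinearBounds.

(** * Truncations and tails *)

Lemma seq_trunc_c00 (s : scalars) (E : banach s) (x : nat -> E) k :
  c00 (seq_trunc x k).
Proof. by exists k => j; rewrite /seq_trunc ltnNge => ->. Qed.

Lemma finitely_determined_trunc_le (s : scalars) (Z : seq_class s) (E : banach s)
    (x : nat -> E) k :
  finitely_determined Z -> seq_mem Z x ->
  seq_norm Z (seq_trunc x k.+1) <= seq_norm Z x.
Proof.
move=> fdZ Zx; have [_ /(_ Zx) eq_sup] := fdZ E x.
have : Rbar_le (seq_norm Z (seq_trunc x k.+1)) (seq_norm Z x) => //.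
rewrite eq_sup.
apply: (Sup_seq_minor_le (fun k => Finite (seq_norm Z (seq_trunc x k.+1))) _ k).
exact: Rbar_le_refl.
Qed.

Lemma finitely_determined_mem (s : scalars) (W : seq_class s) (F : banach s)
    (x : nat -> F) (C : R) :
  finitely_determined W -> (forall k, seq_norm W (seq_trunc x k.+1) <= C) ->
  seq_mem W x.
Proof.
move=> fdW bnd; apply/(fdW F x).1; apply: (Rbar_le_lt_trans _ C) => //.
have [//|/Sup_seq_minor_lt [k /= /Rlt_not_le []]] := Rbar_le_lt_dec
  (Sup_seq (fun k => Finite (seq_norm W (seq_trunc x k.+1)))) C.
exact: bnd.
Qed.

Lemma finite_bound (n : nat) (f : 'I_n -> R) : exists M, forall i, f i <= M.
Proof.
exists (\big[Rmax/0]_(i < n) f i) => i.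
have := mem_index_enum i; elim: (index_enum _) => //= i' r IHr.
rewrite inE big_cons => /orP[/eqP <-|/IHr ir]; first exact: Rmax_l.
exact: Rle_trans ir (Rmax_r _ _).
Qed.

Lemma finitely_shrinking_tail (s : scalars) (Z : seq_class s) (E : banach s)
    (x : nat -> E) m :
  finitely_shrinking Z -> seq_mem Z x ->
  seq_mem Z (seq_tail x m) /\ seq_norm Z (seq_tail x m) <= seq_norm Z x.
Proof.
move=> fsZ Zx; elim: m => [|m [Zm xm]]; first by split=> //; apply: Rle_refl.
have [] := fsZ E (seq_tail x m) 0%nat Zm.
have -> : seq_omit (seq_tail x m) 0 = seq_tail x m.+1.
  by apply: functional_extensionality => j; rewrite /seq_omit /seq_tail addnS.
by move=> ? ?; split=> //; lra.
Qed.

(** Past the truncation point all arguments vanish, and then so does [A],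
    provided that it has an argument at all, here the [k]-th. *)
Lemma induced_trunc (s : scalars) (n : nat) (E : 'I_n -> banach s) (F : banach s)
    (A : (forall i, E i) -> F) (k : 'I_n) (x : forall i, nat -> E i) m :
  multilinear A ->
  induced A (fun i => seq_trunc (x i) m) = seq_trunc (induced A x) m.
Proof.
move=> linA; apply: functional_extensionality => j.
rewrite /seq_trunc /induced; case: ifP => // _.
(* Additivity at [- 0 + 0] in the [k]-th argument gives [A 0 = - A 0 + A 0]. *)
have := linA k (fun i => zero) (opp one) zero zero.
by rewrite !scal_opp_one !plus_opp_l (dfwith_id (fun i => zero : E i) k).
Qed.

(** * The coincidence of the two classes of summing operators *)

Theorem proposition5p1 (s : scalars) (n : nat)
    (X : 'I_n -> seq_class s) (Y Z W : seq_class s)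
    (X_stable : forall i, linearly_stable (X i))
    (Y_stable : linearly_stable Y)
    (Z_stable : linearly_stable Z)
    (W_stable : linearly_stable W)
    (XY_compatible : scalar_compatible X Y)
    (ZW_compatible : scalar_compatible (fun _ : 'I_n => Z) W)
    (Z_fd : finitely_determined Z) (Z_fs : finitely_shrinking Z)
    (W_fd : finitely_determined W) (W_fs : finitely_shrinking W)
    (W_le_Y : fin_le W Y)
    (X_sub_Z : forall i, seq_incl (@seq_mem s (X i)) (@seq_mem s Z))
    (X_le_Z : forall i, fin_le (X i) Z)
    (Xk_sub_Zu : exists k : 'I_n, seq_incl (@seq_mem s (X k)) (seq_mem_u Z))
    (Wu_sub_Y : seq_incl (seq_mem_u W) (@seq_mem s Y)) :
  forall (E : 'I_n -> CompleteNormedModule (field_of s))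
         (F : CompleteNormedModule (field_of s))
         (A : (forall i, E i) -> F),
    summing X Y A <-> summing (fun _ : 'I_n => Z) W A.
Proof.
move=> E F A; have [k Xk_Zu] := Xk_sub_Zu.
split=> sumA; split; try exact: sumA.1; move=> x xmem.
- (* The [Z]-norms of the [x i] bound the [X i]-norms of all their truncations. *)
  have [M xM] := finite_bound (fun i => seq_norm Z (x i)).
  have [C CP] := induced_bounded sumA M.
  apply: (finitely_determined_mem W_fd (C := C)) => m.
  apply: Rle_trans (W_le_Y _ _ (seq_trunc_c00 _ _)) _.
  rewrite -(induced_trunc k _ _ sumA.1.1); apply: CP.
  + by move=> i; apply: seq_mem_c00; apply: seq_trunc_c00.
  + move=> i; apply: Rle_trans (xM i).
    apply: Rle_trans (finitely_determined_trunc_le m Z_fd (xmem i)).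
    exact: X_le_Z _ _ (seq_trunc_c00 _ _).
- have xZ i : seq_mem Z (x i) by apply: X_sub_Z (xmem i).
  apply: Wu_sub_Y; split; first exact: sumA.2.
  (* One constant for all tails at once, so that only the factor coming from
     the tails of [x k] varies with [m]. *)
  pose tails (y : forall i, nat -> E i) := exists m, y = fun i => seq_tail (x i) m.
  have [|v Zv|C [C0 CP]] := slot_bound sumA (k := k) (D := tails).
  + by move=> _ [m ->] i; apply: (finitely_shrinking_tail _ Z_fs (xZ i)).1.
  + have [M xM] := finite_bound (fun i => seq_norm Z (x i)).
    have [c cP] := induced_bounded sumA (Rmax M (seq_norm Z v)).
    exists c => _ [m ->]; apply: cP => i; case: dfwithP => [|i' _] //.
    * exact: (finitely_shrinking_tail _ Z_fs (xZ _)).1.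
    * exact: Rmax_r.
    * apply: Rle_trans (Rmax_l _ _); apply: Rle_trans (xM i').
      exact: (finitely_shrinking_tail _ Z_fs (xZ i')).2.
  have [_ tail_lim] := Xk_Zu _ _ (xmem k).
  apply: is_lim_seq_squeeze0 (is_lim_seq_scal0 C tail_lim) => m.
  change (seq_tail (induced A x) m) with (induced A (fun i => seq_tail (x i) m)).
  split.
    apply/seq_norm_ge0/sumA.2 => i.
    exact: (finitely_shrinking_tail _ Z_fs (xZ i)).1.
  rewrite -(dfwith_id (fun i => seq_tail (x i) m) k).
  apply: CP; first by exists m.
  exact: (finitely_shrinking_tail _ Z_fs (xZ k)).1.
Qed.
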